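(* Let $d,m\ge1$ be integers, $n=d+m$, let $\mathcal{U}\subset\mathbb{R}^{d}$ be open, and let $f=(f_1,\dots,f_m):\mathcal{U}\to\mathbb{R}^{m}$ be twice continuously differentiable; set $\mathcal{M}:=\{(\boldsymbol{x},f(\boldsymbol{x})):\boldsymbol{x}\in\mathcal{U}\}$. Let $\boldsymbol{\tau}=(\tau_1,\dots,\tau_m)$ with all $\tau_i>0$, let $\tilde{\tau}=\frac{1}{m}\sum_{i=1}^{m}\tau_i$, and suppose $\tilde{\tau}m<1$. Then: (i) for any $\boldsymbol{x}=(x_1,\dots,x_d)\in\mathcal{U}$ there is an integer $Q_0$ such that for every $Q\ge Q_0$ there exists $(p_1,\dots,p_n,q)\in\mathbb{Z}^{n}\times\mathbb{N}$ with $1\le q\le Q$ and $(p_1/q,\dots,p_d/q)\in\mathcal{U}$ such that \[ \left| x_{i} - \frac{p_{i}}{q} \right| < \frac{4^{m/d}}{q\,(Q^{1-\tilde{\tau} m})^{1/d}}, \quad 1 \leq i \leq d, \] and \[ \left| f_{j} \left( \frac{p_{1}}{q}, \dots , \frac{p_{d}}{q} \right) - \frac{p_{d+j}}{q} \right| < \frac{q^{-\tau_{j}-1}}{2}, \quad 1 \leq j \leq m; \] (ii) for any $\boldsymbol{x}\in\mathcal{U}\setminus\mathbb{Q}^{d}$ there exist infinitely many $(p_1,\dots,p_n,q)\in\mathbb{Z}^{n}\times\mathbb{N}$ with $(p_1/q,\dots,p_d/q)\in\mathcal{U}$ satisfying \[ \left| f_{j} \left( \frac{p_{1}}{q}, \dots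 , \frac{p_{d}}{q} \right) - \frac{p_{d+j}}{q} \right| < \frac{q^{-\tau_{j}-1}}{2}\ (1 \leq j \leq m)\quad\text{and}\quad \left| x_{i} - \frac{p_{i}}{q} \right| < 4^{m/d} q^{-1-(1-\tilde{\tau} m)/d}\ (1 \leq i \leq d). \] *)

(* Defs.v *)
From HB Require Import structures.
From mathcomp Require Export all_boot all_order all_algebra.
From mathcomp Require Export all_classical all_reals all_analysis.

Set Implicit Arguments.
Unset Strict Implicit.
Unset Printing Implicit Defensive.

Import Order.TTheory GRing.Theory Num.Theory.
Import numFieldNormedType.Exports.

Local Open Scope classical_set_scope.
Local Open Scope ring_scope.

Definition partial (R : realType) (d : nat) (i : 'I_d) (g : 'rV[R]_d -> R) :
    'rV[R]_d -> R :=
  fun x => 'D_(delta_mx 0 i) g x.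

(* All partial derivatives of order at most k exist and are continuous on U.
   Meant for open U: since g is a total function, derivatives and continuity at
   a point of U then depend only on the restriction of g to U. *)
Fixpoint class_C (R : realType) (d k : nat) (U : set 'rV[R]_d)
    (g : 'rV[R]_d -> R) : Prop :=
  {in U, continuous g} /\
  match k with
  | 0 => True
  | k'.+1 => forall i : 'I_d,
      {in U, forall x, derivable g x (delta_mx 0 i)} /\
      class_C k' U (partial i g)
  end.

Definition mean (R : realType) (m : nat) (tau : 'rV[R]_m) : R :=
  m%:R^-1 * \sum_(i < m) tau 0 i.

(* In an integer vector (p_1, ..., p_(d+m)), the first d entries are the
   numerators of the rational point of R^d and the last m entries those of the
   approximation to its image. *)
Definition base_pt (R : realType) (d m : nat) (p : 'rV[int]_(d + m)) (q : nat) :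
    'rV[R]_d :=
  \row_(i < d) ((p 0 (lshift m i))%:~R / q%:R).

Definition image_pt (R : realType) (d m : nat) (p : 'rV[int]_(d + m)) (q : nat) :
    'rV[R]_m :=
  \row_(j < m) ((p 0 (rshift d j))%:~R / q%:R).

Definition rational_points (R : realType) (d : nat) : set 'rV[R]_d :=
  [set x | exists r : 'rV[rat]_d, x = map_mx ratr r].

Arguments base_pt R {d m} p q.
Arguments image_pt R {d m} p q.

(* Main.v *)
(** Linearise [f] at [x] and apply Minkowski's theorem on linear forms to the
    unimodular triangular system [q], [p_i - q x_i],
    [p_(d+j) - q f_j(x) - sum_i D_i f_j(x) (p_i - q x_i)], with bounds
    [floor Q + 1], [delta := 4^(m/d) Q^(-(1 - sum tau)/d)] and
    [Q^(-tau_j) / 4], whose product [(floor Q + 1) / Q] exceeds [1]. The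
    second-order Taylor remainder costs at most [C delta^2 / q] after
    multiplication by [q]; as [tau_j < 1], this is below [q^(-tau_j) / 4] once
    [delta] is small. The second part follows because a non-rational [x] stays
    at positive distance from any finite set of rational points. *)

Require Import Defs.
From mathcomp Require Import all_boot all_order all_algebra.
From mathcomp Require Import all_classical all_reals all_analysis.
From mathcomp Require Import ring lra.

Set Implicit Arguments.
Unset Strict Implicit.
Unset Printing Implicit Defensive.

Import Order.TTheory GRing.Theory Num.Theory.
Import numFieldNormedType.Exports.

Local Open Scope classical_set_scope.
Local Open Scope ring_scope.

(** * Minkowski's theorem for unitriangular systems of linear forms *)

(** Forward substitution along the rank [h]: form [i] is [u i] plus a combination of the [u j] of
    smaller rank, so once these are fixed a ceiling determines [u i]. *)
Lemma unitriangular_round (R : realType) (I : finType) (h : I -> nat)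
    (T : I -> I -> R) :
  (forall i, T i i = 1) ->
  (forall i j, j != i -> (h i <= h j)%N -> T i j = 0) ->
  forall a : I -> int, exists u : I -> int, forall i,
    (a i)%:~R <= \sum_j T i j * (u j)%:~R < (a i + 1)%:~R.
Proof.
move=> T1 T0 a.
suff H k : exists u : I -> int, forall i, (h i < k)%N ->
    (a i)%:~R <= \sum_j T i j * (u j)%:~R < (a i + 1)%:~R.
  have [u uP] := H (\max_i h i).+1.
  by exists u => i; apply: uP; rewrite ltnS leq_bigmax.
elim: k => [|k [u uP]]; first by exists (fun=> 0).
pose s i := \sum_(j | j != i) T i j * (u j)%:~R.
exists (fun i => if h i == k then Num.ceil ((a i)%:~R - s i) else u i) => i.
rewrite ltnS leq_eqVlt => /orP[/eqP hik|hik].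
- rewrite (bigD1 i)//= hik eqxx T1 mul1r.
  rewrite (eq_bigr (fun j => T i j * (u j)%:~R)); last first.
    move=> j ji; case: eqP => // hjk.
    by rewrite T0 ?mul0r// hik hjk.
  have := ceil_itv ((a i)%:~R - s i).
  by rewrite -/(s i) !intrD; lra.
- rewrite (eq_bigr (fun j => T i j * (u j)%:~R)); first exact: uP.
  move=> j _; case: eqP => // hjk.
  rewrite T0 ?mul0r// ?hjk 1?ltnW//.
  by apply: contraTneq hik => <-; rewrite hjk ltnn.
Qed.

(** Truncation costs each factor at most a ratio [t < 1] once the scale is large, and [t] can be
    taken so close to 1 that [t ^+ #|I|] times the product of the [c i] still exceeds 1. *)
Lemma exists_scaled_trunc (R : realType) (I : finType) (c : I -> R) :
  (forall i, 0 < c i) -> 1 < \prod_i c i ->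
  exists k : nat, ((k.+1 ^ #|I|) < \prod_i Num.truncn (k.+1%:R * c i))%N.
Proof.
move=> c0; set P := \prod_i c i => P1.
(* With this exponent, [t ^+ #|I| * P] is [P] to the power [1 / (#|I| + 1)], hence above 1. *)
pose t := P `^ (- (#|I|.+1%:R)^-1).
have P0 : 0 < P by lra.
have n0 : 0 < (#|I|.+1%:R : R)^-1 by rewrite invr_gt0.
have t0 : 0 < t by exact: powR_gt0.
have t1 : t < 1.
  rewrite /t powRN invf_lt1 ?powR_gt0//.
  have := gt0_ltr_powR n0 (_ : 1 \is Num.nneg) (_ : P \is Num.nneg) P1.
  by rewrite powR1 => ->//; rewrite nnegrE ltW.
have tP : 1 < t ^+ #|I| * P.
  rewrite -powR_mulrn ?ltW// /t -powRrM -{2}(powRr1 (ltW P0)) -powRD; last first.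
    by rewrite lt0r_neq0// implybT.
  have -> : - (#|I|.+1%:R)^-1 * #|I|%:R + 1 = (#|I|.+1%:R : R)^-1.
    rewrite -[#|I|.+1]addn1 natrD; field.
    by rewrite -natr1 in n0; rewrite lt0r_neq0// -invr_gt0.
  have := gt0_ltr_powR n0 (_ : 1 \is Num.nneg) (_ : P \is Num.nneg) P1.
  by rewrite powR1 => ->//; rewrite nnegrE ltW.
(* The sum dominates each of its terms, so a scale [k > B] gives [k * c i * (1 - t) > 1]: the gap
   between [k * c i] and [t * (k * c i)] then absorbs the truncation. *)
pose B := \sum_i (c i * (1 - t))^-1.
exists (Num.truncn B); set k := (Num.truncn B).+1.
have Bk : B < k%:R by exact: truncnS_gt.
have k0 : 0 < k%:R :> R by rewrite ltr0n.
rewrite -(ltr_nat R) natrX natr_prod.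
apply: (@lt_le_trans _ _ (\prod_i (t * (k%:R * c i)))).
  rewrite !big_split/= !prodr_const -/P.
  rewrite mulrCA -[ltLHS]mulr1 ltr_pM2l// exprn_gt0//.
apply: ler_prod => i _; rewrite mulr_ge0 ?ltW//= ?mulr_gt0//.
have w0 : 0 < c i * (1 - t) by rewrite mulr_gt0// subr_gt0.
have : (c i * (1 - t))^-1 < k%:R.
  apply: le_lt_trans Bk; rewrite /B (bigD1 i)//= lerDl sumr_ge0// => j _.
  by rewrite invr_ge0 mulr_ge0 ?subr_ge0 ?ltW.
rewrite -[X in X < _]mul1r ltr_pdivrMr// => w1.
have := truncnS_gt (k%:R * c i); rewrite -natr1; nra.
Qed.

Lemma card_dffun_ord (I : finType) (N : I -> nat) :
  #|{dffun forall i : I, 'I_(N i)}| = (\prod_i N i)%N.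
Proof.
rewrite card_dep_ffun foldrE big_map -big_enum/=.
by apply: eq_bigr => i _; rewrite card_ord.
Qed.

(* Blichfeldt's argument in discrete form: the points of [k^-1 Z^I] that the
   forms send into the half-open box [prod [0, c i)] outnumber the classes of
   [k^-1 Z^I] modulo [Z^I], so two of them differ by an integer vector. *)
Lemma unitriangular_Minkowski (R : realType) (I : finType) (h : I -> nat)
    (T : I -> I -> R) (c : I -> R) :
  (forall i, T i i = 1) ->
  (forall i j, j != i -> (h i <= h j)%N -> T i j = 0) ->
  (forall i, 0 < c i) -> 1 < \prod_i c i ->
  exists z : I -> int, (exists i, z i != 0) /\
    forall i, `|\sum_j T i j * (z j)%:~R| < c i.
Proof.
move=> T1 T0 c0 /(exists_scaled_trunc c0)[k kP].
pose N i := Num.truncn (k.+1%:R * c i).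
(* The unit cells with corners [a] tile the box with sides [N i]; each receives the image of an
   integer vector [u a]. *)
have /choice[u uP] : forall a : {dffun forall i : I, 'I_(N i)},
    exists u : I -> int, forall i,
    ((a i : nat)%:Z)%:~R <= \sum_j T i j * (u j)%:~R
                         < ((a i : nat)%:Z + 1)%:~R.
  by move=> a; exact: unitriangular_round T1 T0 _.
pose cls a : {ffun I -> 'I_k.+1} := [ffun i => inord `|(u a i %% k.+1)%Z|%N].
have : ~~ injectiveb cls.
  apply: contraL kP => /injectiveP/leq_card.
  by rewrite card_dffun_ord card_ffun card_ord -leqNgt.
move=> /injectivePn[a [b ab eqab]].
have modE i : (u a i = u b i %[mod k.+1])%Z.
  have /(congr1 val) := congr1 (fun f : {ffun I -> 'I_k.+1} => f i) eqab.
  have lek x : (`|(x %% k.+1)%Z|%N < k.+1)%N.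
    by rewrite -ltz_nat gez0_abs ?modz_ge0// ltz_pmod.
  rewrite !ffunE/= !inordK// => /(congr1 Posz).
  by rewrite !gez0_abs ?modz_ge0.
pose z i := ((u a i - u b i) %/ k.+1)%Z.
have zE i : z i * k.+1 = u a i - u b i.
  by rewrite divzK// -eqz_mod_dvd; apply/eqP.
exists z; split.
  (* If [z] vanished, [u a] and [u b] would coincide, and their common form values would lie in both
     unit cells, forcing [a = b]. *)
  apply/existsP; apply: contraNT ab; rewrite negb_exists => /forallP z0.
  apply/eqP/ffunP => i; apply/val_inj/eqP.
  have uab j : u a j = u b j.
    by apply/eqP; rewrite -subr_eq0 -zE (eqP (negPn (z0 j))) mul0r.
  have := uP a i; have := uP b i; under eq_bigr do rewrite -uab.
  move=> /andP[b1 b2] /andP[a1 a2].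
  have := le_lt_trans a1 b2; have := le_lt_trans b1 a2.
  rewrite !ltr_int !ltzD1 !lez_nat => h1 h2.
  by rewrite eqn_leq h1 h2.
move=> i.
have k0 : 0 < k.+1%:R :> R by [].
rewrite -(ltr_pM2r k0) -{1}[k.+1%:R](gtr0_norm k0) -normrM mulr_suml.
have -> : \sum_j T i j * (z j)%:~R * k.+1%:R =
    \sum_j T i j * (u a j)%:~R - \sum_j T i j * (u b j)%:~R.
  rewrite -sumrB; apply: eq_bigr => j _.
  by rewrite -mulrBr -intrB -zE intrM mulrA.
have := uP a i; have := uP b i; rewrite !intrD -!pmulrn.
(* Both form values lie in [[0, N i)], so they differ by less than [N i]; dividing by [k.+1] gives
   the bound [c i]. *)
have NK : (N i)%:R <= c i * k.+1%:R.
  by rewrite mulrC truncn_le// mulr_ge0// ltW.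
have aN (w : {dffun forall i : I, 'I_(N i)}) : (w i)%:R + 1 <= (N i)%:R :> R.
  by rewrite natr1 ler_nat.
have a0 (w : {dffun forall i : I, 'I_(N i)}) : 0 <= (w i)%:R :> R by [].
have := aN a; have := aN b; have := a0 a; have := a0 b.
by rewrite ltr_norml; lra.
Qed.

(** * Second-order Taylor estimate on boxes from partial derivatives *)

Lemma is_derive_line (R : realType) (V : normedModType R) (g : V -> R)
    (z v : V) (c : R) :
  derivable g (c *: v + z) v ->
  is_derive c 1 (fun t => g (t *: v + z)) ('D_v g (c *: v + z)).
Proof.
pose q1 := fun h : R => h^-1 *: (g (h *: v + (c *: v + z)) - g (c *: v + z)).
have E : (fun h : R => h^-1 *: (((fun t => g (t *: v + z)) \o shift c) (h *: 1)
     - g (c *: v + z))) = q1.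
  by apply/funext => h; rewrite /q1/= [h%:A]mulr1 scalerDl addrA.
by move=> dg; apply: DeriveDef; rewrite /derivable /derive E.
Qed.

(** The one-variable mean value theorem along a line. Working with [|c| <= |t|] lets callers ignore
    the sign of [t]. *)
Lemma MVT_direction (R : realType) (V : normedModType R) (g : V -> R)
    (z v : V) (t : R) :
  (forall c : R, `|c| <= `|t| -> derivable g (c *: v + z) v) ->
  exists2 c : R, `|c| <= `|t| &
    g (t *: v + z) - g z = 'D_v g (c *: v + z) * t.
Proof.
move=> dg.
pose phi (s : R) : R := g (s *: v + z); pose dphi (c : R) : R := 'D_v g (c *: v + z).
have dphiP (c : R) : `|c| <= `|t| -> is_derive c 1 phi (dphi c).
  by move=> /dg; exact: is_derive_line.
have gz : g z = phi 0 by rewrite /phi scale0r add0r.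
have [t0|/ltW t0] := leP 0 t.
- have itvt c : c \in `[0, t] -> `|c| <= `|t|.
    by rewrite in_itv/= => /andP[c0 ct]; rewrite !ger0_norm.
  have [c ct E] : exists2 c, c \in `[0, t] & phi t - phi 0 = dphi c * (t - 0).
    apply: MVT_segment => // [c /subset_itv_oo_cc/itvt/dphiP//|].
    by apply: derivable_within_continuous => c /itvt/dphiP[].
  exists c; last by rewrite gz -/(phi t) E subr0.
  exact: itvt.
- have itvt c : c \in `[t, 0] -> `|c| <= `|t|.
    by rewrite in_itv/= => /andP[ct c0]; rewrite !ler0_norm ?lerN2.
  have [c ct E] : exists2 c, c \in `[t, 0] & phi 0 - phi t = dphi c * (0 - t).
    apply: MVT_segment => // [c /subset_itv_oo_cc/itvt/dphiP//|].
    by apply: derivable_within_continuous => c /itvt/dphiP[].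
  exists c; last by rewrite gz -opprB -/(phi t) E sub0r mulrN opprK.
  exact: itvt.
Qed.

(** A coordinatewise closed box: resetting a coordinate to that of the centre stays inside, as the
    telescoping below requires. *)
Definition in_box (R : realType) (d : nat) (x : 'rV[R]_d) (s : R) :
    set 'rV[R]_d :=
  [set y | forall i, `|y 0 i - x 0 i| <= s].

(** Go from [x] to [y] one coordinate at a time; by the mean value theorem each move contributes an
    error of at most [K * s]. *)
Lemma box_affine_approx (R : realType) (d : nat) (g : 'rV[R]_d -> R)
    (x : 'rV[R]_d) (s K : R) (a : 'I_d -> R) :
  (forall y i, in_box x s y -> derivable g y (delta_mx 0 i) /\
     `|partial i g y - a i| <= K) ->
  forall y, in_box x s y ->
    `|g y - g x - \sum_i a i * (y 0 i - x 0 i)| <= K * s * d%:R.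
Proof.
move=> Hg.
(* Induction on the number [k] of leading coordinates in which [y] may differ from [x]. *)
suff H k : (k <= d)%N -> forall y, in_box x s y ->
    (forall i : 'I_d, (k <= i)%N -> y 0 i = x 0 i) ->
    `|g y - g x - \sum_i a i * (y 0 i - x 0 i)| <= K * s * k%:R.
  by move=> y yB; apply: H => // i; rewrite leqNgt ltn_ord.
elim: k => [|k IH] kd y yB yx.
  have -> : y = x by apply/rowP => i; exact: yx.
  by rewrite big1 ?subrr ?subr0 ?normr0 ?mulr0// => i _; rewrite subrr mulr0.
pose o := Ordinal kd; pose t := y 0 o - x 0 o.
(* The intermediate point: [y] with its last free coordinate reset to that of [x]. *)
pose z : 'rV[R]_d := \row_i (if i == o then x 0 i else y 0 i).
have s0 : 0 <= s by exact: le_trans (yB o).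
have lineE c i : (c *: delta_mx 0 o + z) 0 i =
    if i == o then c + x 0 o else y 0 i.
  rewrite !mxE eqxx/=; case: eqP => [->|_]; first by rewrite mulr1.
  by rewrite mulr0 add0r.
have lineB c : `|c| <= `|t| -> in_box x s (c *: delta_mx 0 o + z).
  move=> ct i; rewrite lineE; case: eqP => [->|_]; last exact: yB.
  by rewrite addrK (le_trans ct)//; exact: yB.
have yE : y = t *: delta_mx 0 o + z.
  by apply/rowP => i; rewrite lineE; case: eqP => [->|//]; rewrite subrK.
have zB : in_box x s z.
  by have := lineB 0; rewrite scale0r add0r normr0; exact.
have [c ct gyz] := @MVT_direction _ _ g z (delta_mx 0 o) t
  (fun c ct => (Hg _ o (lineB c ct)).1).
have [_ Hc] := Hg _ o (lineB c ct); rewrite /partial in Hc.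
have IHz : `|g z - g x - \sum_i a i * (z 0 i - x 0 i)| <= K * s * k%:R.
  apply: IH => //; first exact: ltnW.
  move=> i ki; rewrite mxE; case: eqP => // io; apply: yx.
  by rewrite ltn_neqAle ki andbT; apply: contra_not_neq io => ki'; apply/val_inj.
have sumE : \sum_i a i * (y 0 i - x 0 i) =
    a o * t + \sum_i a i * (z 0 i - x 0 i).
  rewrite (bigD1 o)//= [in RHS](bigD1 o)//= mxE eqxx subrr mulr0 add0r.
  by congr (_ + _); apply: eq_bigr => i /negbTE io; rewrite mxE io.
have -> : g y - g x - \sum_i a i * (y 0 i - x 0 i) =
    ('D_(delta_mx 0 o) g (c *: delta_mx 0 o + z) - a o) * t
    + (g z - g x - \sum_i a i * (z 0 i - x 0 i)).
  by rewrite sumE mulrBl -gyz -yE; ring.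
have -> : K * s * k.+1%:R = K * s + K * s * k%:R by rewrite -natr1; ring.
rewrite (le_trans (ler_normD _ _))// lerD// normrM.
by apply: ler_pM => //; exact: yB.
Qed.

(** [box_affine_approx] is used twice: the bound [K] on second partials makes the first partials
    vary by at most [K * s * d], which in turn bounds the affine error of [g]. *)
Lemma class_C2_remainder (R : realType) (d : nat) (U : set 'rV[R]_d)
    (g : 'rV[R]_d -> R) (x : 'rV[R]_d) :
  open U -> class_C 2 U g -> U x ->
  exists r C : R, [/\ 0 < r, 0 <= C & forall s y, s < r -> in_box x s y ->
    U y /\ `|g y - g x - \sum_i partial i g x * (y 0 i - x 0 i)| <= C * s ^+ 2].
Proof.
move=> oU [_ Cg] Ux.
(* The added 1 leaves room for the second partials to vary near [x], by continuity. *)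
pose K : R := \big[Num.max/0]_(ij : 'I_d * 'I_d)
  (`|partial ij.2 (partial ij.1 g) x| + 1).
have K0 : 0 <= K by exact: bigmax_ge_id.
have : nbhs x (U `&` [set y | forall ij : 'I_d * 'I_d,
    `|partial ij.2 (partial ij.1 g) y| <= K]).
  apply: filterI; first exact: open_nbhs_nbhs.
  apply: (@filter_forall _ _
    (fun ij y => `|partial ij.2 (partial ij.1 g) y| <= K) (nbhs x) _) => -[i j].
  have [_ [_ /(_ j)[_ [cij _]]]] := Cg i.
  have /cvgr_dist_le/(_ 1 ltr01) := cij x (mem_set Ux).
  apply: filterS => y /= xy.
  apply: le_trans (le_bigmax _ _ (i, j)); rewrite /= -lerBlDl.
  by rewrite (le_trans (lerB_dist _ _))// distrC.
move=> /nbhs_ballP[r /= r0 rP].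
have box s y : s < r -> in_box x s y -> ball x r y.
  move=> sr yB; split=> // i j; rewrite ord1 -ball_normE/= distrC.
  exact: le_lt_trans (yB j) sr.
exists r, (K * d%:R * d%:R); split=> //; first by rewrite !mulr_ge0.
move=> s y sr yB; split; first by have [] := rP _ (box _ _ sr yB).
have -> : K * d%:R * d%:R * s ^+ 2 = (K * s * d%:R) * s * d%:R by ring.
apply: (@box_affine_approx _ _ _ _ s) => // w i wB.
have [Uw _] := rP _ (box _ _ sr wB).
have [/(_ w (mem_set Uw)) dgw [_ Cgi]] := Cg i; split=> //.
(* Slopes 0 turn the affine estimate into a Lipschitz bound for [partial i g]. *)
have := @box_affine_approx _ _ (partial i g) x s K (fun=> 0) _ w wB.
under eq_bigr do rewrite mul0r.
rewrite big1_eq subr0; apply => v j vB.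
have [Uv /(_ (i, j)) Kv] := rP _ (box _ _ sr vB); rewrite subr0; split=> //.
by have [/(_ v (mem_set Uv))] := Cgi j.
Qed.

(** * The linear forms attached to a point and a linearised map *)

(** The unknowns [q], [p], [r] get ranks 0, 1, 2, which makes the system unitriangular. The bounds
    [c1 <= 1] and [c2 j <= 1] serve to exclude [q = 0]. *)
Lemma simultaneous_affine_forms (R : realType) (d m : nat) (x : 'I_d -> R)
    (y : 'I_m -> R) (g : 'I_m -> 'I_d -> R) (c0 c1 : R) (c2 : 'I_m -> R) :
  0 < c0 -> 0 < c1 <= 1 -> (forall j, 0 < c2 j <= 1) ->
  1 < c0 * (c1 ^+ d * \prod_j c2 j) ->
  exists (q : nat) (p : 'I_d -> int) (r : 'I_m -> int),
    [/\ (0 < q)%N, q%:R < c0,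
        forall i, `|q%:R * x i - (p i)%:~R| < c1 &
        forall j, `|q%:R * y j + \sum_i g j i * ((p i)%:~R - q%:R * x i)
                    - (r j)%:~R| < c2 j].
Proof.
move=> c00 /andP[c10 c11] c2P cP.
pose I : finType := ('I_1 + ('I_d + 'I_m))%type.
pose h (i : I) : nat :=
  match i with inl _ => 0 | inr (inl _) => 1 | inr (inr _) => 2 end.
pose T (i k : I) : R := match i, k with
  | inl _, inl _ => 1
  | inr (inl i), inl _ => - x i
  | inr (inl i), inr (inl k) => (i == k)%:R
  | inr (inr j), inl _ => \sum_i g j i * x i - y j
  | inr (inr j), inr (inl k) => - g j k
  | inr (inr j), inr (inr k) => (j == k)%:R
  | _, _ => 0 end.
pose c (i : I) : R :=
  match i with inl _ => c0 | inr (inl _) => c1 | inr (inr j) => c2 j end.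
have TE0 (z : I -> int) : \sum_k T (inl ord0) k * (z k)%:~R = (z (inl ord0))%:~R.
  rewrite big_sumType big_ord1/= mul1r big1 ?addr0// => -[k|k] _;
  by rewrite mul0r.
have TE1 (z : I -> int) i : \sum_k T (inr (inl i)) k * (z k)%:~R =
    (z (inr (inl i)))%:~R - (z (inl ord0))%:~R * x i.
  rewrite big_sumType big_ord1 big_sumType/= [X in _ + (_ + X)]big1 ?addr0.
    by rewrite (bigD1 i)//= eqxx mul1r big1 ?addr0;
       [ring|move=> k /negbTE ki; rewrite eq_sym ki mul0r].
  by move=> k _; rewrite mul0r.
have TE2 (z : I -> int) j : \sum_k T (inr (inr j)) k * (z k)%:~R =
    (z (inr (inr j)))%:~R - ((z (inl ord0))%:~R * y j
      + \sum_i g j i * ((z (inr (inl i)))%:~R - (z (inl ord0))%:~R * x i)).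
  rewrite big_sumType big_ord1 big_sumType/= [X in _ + (_ + X)](bigD1 j)//=.
  rewrite eqxx mul1r [X in _ + (_ + (_ + X))]big1 ?addr0; last first.
    by move=> k /negbTE kj; rewrite eq_sym kj mul0r.
  rewrite [in RHS](eq_bigr (fun i => g j i * (z (inr (inl i)))%:~R
    - g j i * x i * (z (inl ord0))%:~R)); last by move=> i _; ring.
  rewrite sumrB -mulr_suml.
  under [X in _ + (X + _)]eq_bigr do rewrite mulNr.
  by rewrite sumrN; ring.
have [z [z0 zP]] : exists z : I -> int, (exists i, z i != 0) /\
    forall i, `|\sum_j T i j * (z j)%:~R| < c i.
  apply: (@unitriangular_Minkowski _ _ h).
  - by move=> [i|[i|i]]//=; rewrite eqxx.
  - move=> [i|[i|i]] [k|[k|k]]//=; first by rewrite !ord1 eqxx.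
    + by move=> ki _; case: eqP => // ik; rewrite ik eqxx in ki.
    + by move=> ki _; case: eqP => // ik; rewrite ik eqxx in ki.
  - by move=> [i|[i|j]]//=; have /andP[] := c2P j.
  - by rewrite big_sumType big_ord1 big_sumType/= prodr_const card_ord.
have small_int (a : int) : `|a%:~R| < 1 :> R -> a = 0.
  by rewrite -intr_norm -[1]/(1%:~R) ltr_int; case: a => [[]|].
(* If [q = 0], the middle forms give integers [p i] of absolute value below 1, so [p = 0]; then
   [r = 0] likewise, against [z] being nonzero. *)
have q0 : z (inl ord0) != 0.
  apply/eqP => q0; have p0 i : z (inr (inl i)) = 0.
    apply: small_int; have := zP (inr (inl i)).
    by rewrite TE1 q0 mul0r subr0 => /lt_le_trans; apply.
  have r0 j : z (inr (inr j)) = 0.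
    apply: small_int; have := zP (inr (inr j)).
    rewrite TE2 q0 mul0r big1 ?addr0 ?subr0 => [/lt_le_trans|i _].
      by apply; have /andP[] := c2P j.
    by rewrite p0 mul0r subr0 mulr0.
  by case: z0 => -[i|[i|i]]; rewrite ?p0 ?r0 ?ord1 ?q0 eqxx.
(* The bounds are symmetric under [z -> -z], so [q] may be taken positive. *)
have {z0} [w [w0 wP]] : exists w : I -> int, 0 < w (inl ord0) /\
    forall i, `|\sum_j T i j * (w j)%:~R| < c i.
  have [z1|z1] := ltP 0 (z (inl ord0)); first by exists z.
  exists (fun i => - z i); split; first by rewrite oppr_gt0 lt_neqAle q0.
  move=> i; under eq_bigr do rewrite intrN mulrN.
  by rewrite sumrN normrN.
have wq : (w (inl ord0))%:~R = `|w (inl ord0)|%N%:R :> R.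
  by rewrite pmulrn gtz0_abs.
exists `|w (inl ord0)|%N, (fun i => w (inr (inl i))), (fun j => w (inr (inr j))).
split.
- by rewrite -ltz_nat gtz0_abs.
- have := wP (inl ord0); rewrite TE0 wq /c.
  by rewrite ger0_norm.
- by move=> i; have := wP (inr (inl i)); rewrite TE1 wq distrC.
- by move=> j; have := wP (inr (inr j)); rewrite TE2 wq distrC.
Qed.

(** * Real powers, and Taylor constants common to all components *)

Lemma powR_sum (R : realType) (I : finType) (a : R) (t : I -> R) :
  0 < a -> a `^ (\sum_i t i) = \prod_i a `^ t i.
Proof.
move=> a0; apply: big_morph; last exact: powRr0.
by move=> r s; rewrite powRD// (lt0r_neq0 a0) implybT.
Qed.

Lemma powR_eventually_gt (R : realType) (a B : R) : 0 < a ->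
  exists2 Q0 : int, 1 <= Q0%:~R :> R & forall Q : R, Q0%:~R <= Q -> B < Q `^ a.
Proof.
move=> a0; exists (Num.ceil (1 + (`|B| + 1) `^ a^-1)).
  by rewrite (le_trans _ (ceil_ge _))// lerDl powR_ge0.
move=> Q /(le_trans (ceil_ge _)) hQ.
have B0 : 0 <= (`|B| + 1) `^ a^-1 by exact: powR_ge0.
apply: (@lt_le_trans _ _ (`|B| + 1)); first by rewrite ltr_pwDr// ler_norm.
have B1 : 0 <= `|B| + 1 by rewrite addr_ge0.
have -> : `|B| + 1 = ((`|B| + 1) `^ a^-1) `^ a.
  by rewrite -powRrM mulVf ?powRr1// lt0r_neq0.
by apply: ge0_ler_powR; rewrite ?nnegrE ?(ltW a0)//=; lra.
Qed.

Lemma mean_mulr (R : realType) (m : nat) (tau : 'rV[R]_m) : (0 < m)%N ->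
  mean tau * m%:R = \sum_j tau 0 j.
Proof. by move=> m0; rewrite /mean mulrAC mulVf ?mul1r// pnatr_eq0 -lt0n. Qed.

Lemma class_C2_remainders (R : realType) (d m : nat) (U : set 'rV[R]_d)
    (f : 'rV[R]_d -> 'rV[R]_m) (x : 'rV[R]_d) :
  open U -> (forall j, class_C 2 U (fun x => f x 0 j)) -> U x -> (0 < m)%N ->
  exists r C : R, [/\ 0 < r, 0 <= C & forall s y, s < r -> in_box x s y ->
    U y /\ forall j, `|f y 0 j - f x 0 j - \sum_i partial i (fun x => f x 0 j) x
                        * (y 0 i - x 0 i)| <= C * s ^+ 2].
Proof.
move=> oU Cf Ux m0.
have /choice[rC rCP] : forall j : 'I_m, exists rC : R * R,
    [/\ 0 < rC.1, 0 <= rC.2 & forall s y, s < rC.1 -> in_box x s y ->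
    U y /\ `|f y 0 j - f x 0 j - \sum_i partial i (fun x => f x 0 j) x
                        * (y 0 i - x 0 i)| <= rC.2 * s ^+ 2].
  move=> j; have [r [C rCP]] := class_C2_remainder oU (Cf j) Ux.
  by exists (r, C).
(* The defaults 1 and 0 keep the radius positive and the constant nonnegative. *)
exists (\big[Num.min/1]_j (rC j).1), (\big[Num.max/0]_j (rC j).2); split.
- by apply: lt_bigmin => // j _; have [] := rCP j.
- exact: bigmax_ge_id.
- move=> s y sr yB.
  have {}sr j : s < (rC j).1 by exact: lt_le_trans sr (bigmin_le _ j _).
  split; first by have [_ _ /(_ s y (sr _) yB)[]] := rCP (Ordinal m0).
  move=> j; have [_ _ /(_ s y (sr _) yB)[_ Hj]] := rCP j.
  by rewrite (le_trans Hj)// ler_wpM2r ?sqr_ge0//; exact: le_bigmax.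
Qed.

(** * Part (i): a rational point near the graph for every large [Q] *)

Section RationalPointsNearGraph.
Variables (R : realType) (d m : nat).
Hypotheses (hd : (1 <= d)%N) (hm : (1 <= m)%N).
Variables (U : set 'rV[R]_d) (f : 'rV[R]_d -> 'rV[R]_m) (tau : 'rV[R]_m).
Hypotheses (hU : open U) (hf : forall j : 'I_m, class_C 2 U (fun x => f x 0 j)).
Hypotheses (htau : forall j : 'I_m, 0 < tau 0 j) (htau1 : mean tau * m%:R < 1).

Let A : R := 4 `^ (m%:R / d%:R).
Let beta : R := 1 - mean tau * m%:R.
Let delta (Q : R) : R := A / (Q `^ beta) `^ (d%:R^-1).

Let d0 : (0 : R) < d%:R. Proof. by rewrite ltr0n. Qed.
Let A0 : 0 < A. Proof. exact: powR_gt0. Qed.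
Let beta_div_gt0 : 0 < beta / d%:R.
Proof. by rewrite divr_gt0// subr_gt0. Qed.

Let delta_gt0 Q : 0 < Q -> 0 < delta Q.
Proof. by move=> Q0; rewrite divr_gt0// !powR_gt0. Qed.

Let deltaE Q : delta Q = A / Q `^ (beta / d%:R).
Proof. by rewrite /delta powRrM. Qed.

Let delta_small e : 0 < e -> exists2 Q0 : int, 1 <= Q0%:~R :> R &
  forall Q : R, Q0%:~R <= Q -> delta Q < e.
Proof.
move=> e0; have [Q0 Q01 Q0P] := powR_eventually_gt (A / e) beta_div_gt0.
exists Q0 => // Q Q0Q; have := Q0P Q Q0Q; rewrite ltr_pdivrMr// => AQ.
by rewrite deltaE ltr_pdivrMr ?powR_gt0 1?mulrC//; lra.
Qed.

(** Gives [q^(-1) <= q^(-tau_j)], by which the Taylor remainder is absorbed. *)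
Let tau_le1 j : tau 0 j <= 1.
Proof.
apply: ltW; apply: le_lt_trans htau1; rewrite mean_mulr// (bigD1 j)//= lerDl.
by apply: sumr_ge0 => i _; exact: ltW.
Qed.

(** The constant in [delta] is chosen so that [4 ^+ m] cancels the [m] factors [1/4]; the exponents
    [- beta] and minus the sum of the [tau 0 j] add up to -1. *)
Let volume Q : 0 < Q ->
  delta Q ^+ d * \prod_j (Q `^ (- tau 0 j) / 4) = Q^-1.
Proof.
move=> Q0; have Qn0 := lt0r_neq0 Q0; have dn0 := lt0r_neq0 d0.
rewrite big_split/= -powR_sum// sumrN -mean_mulr// prodr_const card_ord.
have -> : delta Q ^+ d = 4 ^+ m * Q `^ (- beta).
  rewrite deltaE exprMn exprVn -!powR_mulrn ?powR_ge0// -!powRrM.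
  by rewrite !divfK// powRN.
rewrite [X in _ * X]mulrC mulrACA -exprMn divff// expr1n mul1r.
rewrite -powRD ?Qn0 ?implybT// -(powR_inv1 (ltW Q0)); congr (_ `^ _).
by rewrite /beta; ring.
Qed.

Lemma rational_points_near_graph (x : 'rV[R]_d) : U x ->
  exists Q0 : int, forall Q : R, Q0%:~R <= Q ->
    exists (p : 'rV[int]_(d + m)) (q : nat),
      [/\ (1 <= q)%N /\ q%:R <= Q,
          U (base_pt R p q),
          forall i : 'I_d,
            `|x 0 i - base_pt R p q 0 i| <
            4 `^ (m%:R / d%:R) /
              (q%:R * (Q `^ (1 - mean tau * m%:R)) `^ (d%:R^-1)) &
          forall j : 'I_m,
            `|f (base_pt R p q) 0 j - image_pt R p q 0 j| <
            q%:R `^ (- tau 0 j - 1) / 2].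
Proof.
move=> Ux.
have [r [C [r0 C0 rC]]] := class_C2_remainders hU hf Ux hm.
(* [delta < r] keeps the rational point within the Taylor radius; the other bound gives both
   [delta <= 1] and [C * delta ^+ 2 <= 1/4]. *)
pose e := Num.min r (4 * (C + 1))^-1.
have C10 : 0 < 4 * (C + 1) by lra.
have e0 : 0 < e by rewrite lt_min r0 invr_gt0.
have [Q0 Q01 Q0P] := delta_small e0.
exists Q0 => Q Q0Q.
have Q1 : 1 <= Q by exact: le_trans Q0Q.
have Qgt0 : 0 < Q by lra.
have : delta Q < e by exact: Q0P.
have dl0 : 0 < delta Q by exact: delta_gt0.
rewrite lt_min -[X in _ && (_ < X)]div1r ltr_pdivlMr// => /andP[dr dC].
pose D j i := partial i (fun x => f x 0 j) x.
(* The bound on [q] is an integer exceeding [Q]: the product of the bounds is above 1, yet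
   [q < floor Q + 1] still yields [q <= Q]. *)
have [q [p [s [q0 qQ pP sP]]]] : exists (q : nat) (p : 'I_d -> int)
    (s : 'I_m -> int), [/\ (0 < q)%N, q%:R < (Num.floor Q + 1)%:~R :> R,
    forall i, `|q%:R * x 0 i - (p i)%:~R| < delta Q &
    forall j, `|q%:R * f x 0 j + \sum_i D j i * ((p i)%:~R - q%:R * x 0 i)
                - (s j)%:~R| < Q `^ (- tau 0 j) / 4].
  have /andP[_ Qfl] := floor_itv Q.
  apply: simultaneous_affine_forms.
  - exact: lt_trans Qfl.
  - by rewrite dl0; nra.
  - move=> j; rewrite divr_gt0 ?powR_gt0//=.
    have : Q `^ (- tau 0 j) <= Q `^ 0 by rewrite ler_powR// oppr_le0 ltW.
    by rewrite powRr0; lra.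
  - by rewrite volume// ltr_pdivlMr// mul1r.
have {}qQ : q%:R <= Q.
  have /andP[flQ _] := floor_itv Q; apply: le_trans flQ.
  by move: qQ; rewrite pmulrn ltr_int ltzD1 ler_int.
have q1 : 1 <= q%:R :> R by rewrite ler1n.
have qgt0 : 0 < q%:R :> R by lra.
have qn0 := lt0r_neq0 qgt0.
pose pp : 'rV[int]_(d + m) := row_mx (\row_i p i) (\row_j s j).
have bE i : base_pt R pp q 0 i = (p i)%:~R / q%:R.
  by rewrite mxE row_mxEl mxE.
have iE j : image_pt R pp q 0 j = (s j)%:~R / q%:R.
  by rewrite mxE row_mxEr mxE.
have bx i : `|x 0 i - base_pt R pp q 0 i| < delta Q / q%:R.
  rewrite bE ltr_pdivlMr// -{2}(gtr0_norm qgt0) -normrM mulrBl divfK//.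
  by rewrite mulrC.
have bB : in_box x (delta Q / q%:R) (base_pt R pp q).
  by move=> i; rewrite distrC ltW.
have dqr : delta Q / q%:R < r.
  by apply: le_lt_trans dr; rewrite ler_pdivrMr// ler_peMr// ltW.
have [Ub remP] := rC _ _ dqr bB.
exists pp, q; split=> // [i|j].
  by have := bx i; rewrite /delta -mulrA -invfM [_ * q%:R]mulrC.
have qtau : q%:R `^ (- tau 0 j - 1) = q%:R `^ (- tau 0 j) / q%:R.
  by rewrite powRD ?qn0 ?implybT// powR_inv1// ltW.
rewrite iE qtau mulrAC ltr_pdivlMr// -{2}(gtr0_norm qgt0) -normrM mulrBl divfK//.
have {}remP := remP j; set rem := f _ 0 j - f x 0 j - _ in remP.
(* The error times [q] splits into the affine form, below [Q^(-tau_j) / 4], and [q] times the Taylor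
   remainder, at most [q^(-tau_j) / 4]; [q <= Q] makes the sum less than [q^(-tau_j) / 2]. *)
have remE : f (base_pt R pp q) 0 j * q%:R - (s j)%:~R =
    (q%:R * f x 0 j + \sum_i D j i * ((p i)%:~R - q%:R * x 0 i) - (s j)%:~R)
    + q%:R * rem.
  have -> : \sum_i D j i * ((p i)%:~R - q%:R * x 0 i) =
      q%:R * \sum_i D j i * (base_pt R pp q 0 i - x 0 i).
    rewrite mulr_sumr; apply: eq_bigr => i _; rewrite bE mulrCA; congr (_ * _).
    by field.
  by rewrite /rem; ring.
have qrem : `|q%:R * rem| <= q%:R `^ (- tau 0 j) / 4.
  rewrite normrM (gtr0_norm qgt0).
  have : q%:R `^ (-1) <= q%:R `^ (- tau 0 j) by rewrite ler_powR// lerN2.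
  rewrite powR_inv1 ?(ltW qgt0)// => qtau1.
  suff : q%:R * `|rem| <= q%:R^-1 / 4 by lra.
  apply: (@le_trans _ _ (q%:R * (C * (delta Q / q%:R) ^+ 2))).
    by rewrite ler_pM2l//; exact: remP.
  have -> : q%:R * (C * (delta Q / q%:R) ^+ 2) = q%:R^-1 * (C * delta Q ^+ 2).
    by field.
  rewrite ler_pM2l ?invr_gt0//.
  have : C * delta Q <= 4^-1 by lra.
  nra.
have Qtau : Q `^ (- tau 0 j) <= q%:R `^ (- tau 0 j).
  rewrite !powRN lef_pV2 ?posrE ?powR_gt0//.
  by apply: ge0_ler_powR; rewrite ?nnegrE ?(ltW qgt0) ?(ltW Qgt0) ?(ltW (htau j)).
rewrite remE; apply: le_lt_trans (ler_normD _ _) _.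
by have := sP j; lra.
Qed.
End RationalPointsNearGraph.

(** * Part (ii): infinitely many solutions at a non-rational point *)

Lemma base_pt_rational (R : realType) (d m : nat) (p : 'rV[int]_(d + m))
    (q : nat) : rational_points (base_pt R p q).
Proof.
exists (\row_i ((p 0 (lshift m i))%:~R / q%:R)); apply/rowP => i.
by rewrite !mxE fmorph_div/= ratr_int ratr_nat.
Qed.

Lemma seq_common_lower_bound (R : realType) (T : eqType) (s : seq T)
    (F : T -> R) : (forall t, 0 < F t) ->
  exists2 e : R, 0 < e & {in s, forall t, e <= F t}.
Proof.
move=> F0; elim: s => [|a s [e e0 eP]]; first by exists 1.
exists (Num.min (F a) e); first by rewrite lt_min F0.
move=> t; rewrite inE => /orP[/eqP->|/eP et]; first by rewrite ge_min lexx.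
by rewrite ge_min et orbT.
Qed.

Theorem theorem3p1 (R : realType) (d m : nat) (hd : (1 <= d)%N) (hm : (1 <= m)%N)
    (U : set 'rV[R]_d) (hU : open U)
    (f : 'rV[R]_d -> 'rV[R]_m)
    (hf : forall j : 'I_m, class_C 2 U (fun x => f x 0 j))
    (tau : 'rV[R]_m) (htau : forall j : 'I_m, 0 < tau 0 j)
    (htau1 : mean tau * m%:R < 1) :
  (forall x : 'rV[R]_d, U x ->
     exists Q0 : int, forall Q : R, Q0%:~R <= Q ->
       exists (p : 'rV[int]_(d + m)) (q : nat),
         [/\ (1 <= q)%N /\ q%:R <= Q,
             U (base_pt R p q),
             forall i : 'I_d,
               `|x 0 i - base_pt R p q 0 i| <
               4 `^ (m%:R / d%:R) /
                 (q%:R * (Q `^ (1 - mean tau * m%:R)) `^ (d%:R^-1)) &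
             forall j : 'I_m,
               `|f (base_pt R p q) 0 j - image_pt R p q 0 j| <
               q%:R `^ (- tau 0 j - 1) / 2])
  /\
  (forall x : 'rV[R]_d, (U `\` @rational_points R d) x ->
     infinite_set [set pq : 'rV[int]_(d + m) * nat |
       [/\ (1 <= pq.2)%N,
           U (base_pt R pq.1 pq.2),
           forall j : 'I_m,
             `|f (base_pt R pq.1 pq.2) 0 j - image_pt R pq.1 pq.2 0 j| <
             pq.2%:R `^ (- tau 0 j - 1) / 2 &
           forall i : 'I_d,
             `|x 0 i - base_pt R pq.1 pq.2 0 i| <
             4 `^ (m%:R / d%:R) *
               pq.2%:R `^ (- 1 - (1 - mean tau * m%:R) / d%:R)]]).
Proof.
split; first by move=> x; exact: rational_points_near_graph.
move=> x [Ux xQ] /finite_seqP[s sE].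
have d0 : 0 < d%:R :> R by rewrite ltr0n.
have a0 : 0 < (1 - mean tau * m%:R) / d%:R by rewrite divr_gt0// subr_gt0.
set a := (1 - mean tau * m%:R) / d%:R in a0 sE.
set A : R := 4 `^ (m%:R / d%:R) in sE.
have A0 : 0 < A by exact: powR_gt0.
(* Sup-norm distance from [x], positive because [x] is not rational; over the finite list [s] of
   supposed solutions it has a lower bound [e > 0]. *)
pose dist (pq : 'rV[int]_(d + m) * nat) : R :=
  \big[Num.max/0]_i `|x 0 i - base_pt R pq.1 pq.2 0 i|.
have dist0 pq : 0 < dist pq.
  rewrite lt_neqAle bigmax_ge_id andbT eq_sym; apply/eqP => dist0; apply: xQ.
  suff -> : x = base_pt R pq.1 pq.2 by exact: base_pt_rational.
  apply/rowP => i; apply/eqP; rewrite -subr_eq0 -normr_le0 -dist0.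
  exact: le_bigmax.
have [e e0 eP] := seq_common_lower_bound s dist0.
have [Q0 Q0P] := rational_points_near_graph hd hm hU hf htau htau1 Ux.
have [Q1 Q11 Q1P] := powR_eventually_gt (A / e) a0.
(* Large enough for part (i) to apply and for its bound on [x] to fall below [e]. *)
pose Q : R := Num.max Q0%:~R Q1%:~R.
have Q1Q : Q1%:~R <= Q by rewrite le_max lexx orbT.
have [|p [q [[q1 qQ] Ub xb fb]]] := Q0P Q; first by rewrite le_max lexx.
have AQ : A / Q `^ a < e.
  have := Q1P Q Q1Q; rewrite ltr_pdivrMr// ltr_pdivrMr ?powR_gt0 1?mulrC//.
  by lra.
have Qgt0 : 0 < Q by lra.
have qgt0 : 0 < q%:R :> R by rewrite ltr0n.
have {}xb i : `|x 0 i - base_pt R p q 0 i| < A / (q%:R * Q `^ a).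
  by rewrite /a powRrM; exact: xb.
(* Since [q <= Q], the bound [A / (q * Q^a)] is at most [A * q^(-1 - a)], so the pair is a solution
   and must be listed. *)
have pq_s : (p, q) \in s.
  suff : [set` s] (p, q) by [].
  rewrite -sE; split=> //= i; apply: lt_le_trans (xb i) _.
  rewrite ler_pM2l// powRD ?(lt0r_neq0 qgt0) ?implybT// powR_inv1 ?(ltW qgt0)// invfM.
  rewrite ler_pM2l ?invr_gt0// powRN lef_pV2 ?posrE ?powR_gt0//.
  by apply: ge0_ler_powR; rewrite ?nnegrE ?(ltW qgt0) ?(ltW Qgt0) ?(ltW a0).
(* As [q >= 1], the same bound is at most [A / Q^a < e], contradicting the choice of [e]. *)
have := eP _ pq_s; apply/negP; rewrite -ltNge.
apply: bigmax_lt => // i _; apply: lt_trans AQ; apply: lt_le_trans (xb i) _.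
rewrite ler_pM2l// lef_pV2 ?posrE ?mulr_gt0 ?powR_gt0//.
by rewrite ler_peMl ?powR_ge0// ler1n.
Qed.
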